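(* Let $W^{\rm inc}:\mathrm{SL}(2)\to\mathbb{R}$ be objective and isotropic, and assume that $W^{\rm inc}$ is polyconvex and differentiable. Then $W^{\rm inc}$ satisfies the weak Hill inequality, i.e. for all symmetric positive definite $V_1,V_2\in\mathbb{R}^{2\times 2}$ with $\det V_1=\det V_2=1$, $$\langle \widehat{\boldsymbol{\tau}}(\log V_1)-\widehat{\boldsymbol{\tau}}(\log V_2),\ \log V_1-\log V_2\rangle\ \ge\ 0,$$ where $\widehat{\boldsymbol{\tau}}$ is the Kirchhoff stress tensor associated with $W^{\rm inc}$.
   Context: $\mathrm{SL}(2)=\{F\in\mathbb{R}^{2\times2}\mid \det F=1\}$, regarded as a smooth submanifold of $\mathbb{R}^{2\times 2}$ (differentiability of $W^{\rm inc}$ is meant on this manifold). $\langle X,Y\rangle=\operatorname{tr}(Y^TX)$ is the Frobenius inner product. Objective and isotropic: $W^{\rm inc}(Q_1FQ_2)=W^{\rm inc}(F)$ for all $F\in\mathrm{SL}(2)$ and all $Q_1,Q_2\in\mathrm{SO}(2)$. Polyconvex: there is a convex function $P:\mathbb{R}^{2\times2}\times\mathbb{R}\to\mathbb{R}\cup\{\infty\}$ such that $W^{\rm inc}(F)=P(F,1)$ for all $F\in\mathrm{SL}(2)$. Kirchhoff stress: let $\operatorname{dev}\mathrm{Sym}(2)=\{X\in\mathbb{R}^{2\times2}\mid X^T=X,\ \operatorname{tr}X=0\}$. The matrix logarithm maps the symmetric positive definite matrices of determinant $1$ bijectively onto $\operatorname{dev}\mathrm{Sym}(2)$, with inverse $\exp$.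 Define $\widehat W^{\rm inc}:\operatorname{dev}\mathrm{Sym}(2)\to\mathbb{R}$ by $\widehat W^{\rm inc}(X)=W^{\rm inc}(\exp X)$. The Kirchhoff stress tensor $\widehat{\boldsymbol{\tau}}:\operatorname{dev}\mathrm{Sym}(2)\to\operatorname{dev}\mathrm{Sym}(2)$ is the intrinsic gradient of $\widehat W^{\rm inc}$, i.e. $\widehat{\boldsymbol{\tau}}(X)$ is the unique element of $\operatorname{dev}\mathrm{Sym}(2)$ with $$\langle\widehat{\boldsymbol{\tau}}(X),H\rangle=\lim_{t\to0}\frac{\widehat W^{\rm inc}(X+tH)-\widehat W^{\rm inc}(X)}{t}\qquad\text{for all }H\in\operatorname{dev}\mathrm{Sym}(2).$$ *)

(* Defs.v *)
From HB Require Import structures.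
From mathcomp Require Import all_boot all_order all_algebra.
From mathcomp Require Import all_classical all_reals all_analysis.

Set Implicit Arguments.
Unset Strict Implicit.
Unset Printing Implicit Defensive.

Import Order.TTheory GRing.Theory Num.Theory.
Import numFieldNormedType.Exports.

Local Open Scope classical_set_scope.
Local Open Scope ring_scope.

(* An energy on SL(2) is represented by a total function 'M[R]_2 -> R; every
   notion below depends only on its values on SL2, those outside are junk. *)
Definition SL2 (R : realType) : set 'M[R]_2 := [set F | \det F = 1].

Definition SO2 (R : realType) : set 'M[R]_2 :=
  [set Q | Q^T *m Q = 1%:M /\ \det Q = 1].

Definition devSym2 (R : realType) : set 'M[R]_2 :=
  [set X | X^T = X /\ \tr X = 0].

Definition spd (R : realType) (n : nat) : set 'M[R]_n :=
  [set V | V^T = V /\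
    forall x : 'cV[R]_n, x != 0 -> 0 < (x^T *m V *m x) ord0 ord0].

Definition frob (R : realType) (n : nat) (X Y : 'M[R]_n) : R :=
  \tr (Y^T *m X).

Definition objective_isotropic (R : realType) (W : 'M[R]_2 -> R) : Prop :=
  forall F Q1 Q2 : 'M[R]_2,
    SL2 F -> SO2 Q1 -> SO2 Q2 -> W (Q1 *m F *m Q2) = W F.

(* Convexity for values in R `|` {+oo}: -oo is excluded, so the sum on the
   right-hand side is never of the form +oo - oo; at the endpoints the
   convention 0 * +oo = 0 makes the inequality trivial. *)
Definition econvex (R : realType) (E : lmodType R) (P : E -> \bar R) : Prop :=
  (forall x, P x != -oo%E) /\
  forall (x y : E) (t : R), 0 <= t <= 1 ->
    (P ((1 - t) *: x + t *: y)%R <= (1 - t)%:E * P x + t%:E * P y)%E.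

Definition polyconvex (R : realType) (W : 'M[R]_2 -> R) : Prop :=
  exists P : 'M[R]_2 * R^o -> \bar R,
    econvex P /\ forall F, SL2 F -> (W F)%:E = P (F, 1).

(* Differentiability on the embedded submanifold SL(2) of 'M[R]_2: around each
   of its points W is the restriction of a function on the ambient space which
   is (Frechet) differentiable at that point. *)
Definition differentiable_SL2 (R : realType) (W : 'M[R]_2 -> R) : Prop :=
  forall F, SL2 F -> exists g : 'M[R]_2 -> R,
    differentiable g F /\ \forall G \near F, SL2 G -> g G = W G.

Definition expm (R : realType) (n : nat) (X : 'M[R]_n.+1) : 'M[R]_n.+1 :=
  limn (series (fun k : nat => (k`!%:R)^-1 *: X ^+ k)).

(* Meaningful for V symmetric positive definite: the unique symmetric matrix
   whose exponential is V, i.e. the principal logarithm. Junk value 0 if there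
   is no such matrix. *)
Definition logm (R : realType) (n : nat) (V : 'M[R]_n.+1) : 'M[R]_n.+1 :=
  xget 0 [set X | X^T = X /\ expm X = V].

Definition What (R : realType) (W : 'M[R]_2 -> R) (X : 'M[R]_2) : R :=
  W (expm X).

Definition is_kirchhoff (R : realType) (W : 'M[R]_2 -> R) (X T : 'M[R]_2) :
    Prop :=
  devSym2 T /\ forall H, devSym2 H ->
    t^-1 * (What W (X + t *: H) - What W X) @[t --> (0 : R)^'] --> frob T H.

(* Such a T is unique, frob being positive definite on devSym2; the value is
   the junk 0 only where the intrinsic gradient does not exist. *)
Definition kirchhoff (R : realType) (W : 'M[R]_2 -> R) (X : 'M[R]_2) :
    'M[R]_2 :=
  xget 0 [set T | is_kirchhoff W X T].

(* Main.v *)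
Require Import Defs.
From mathcomp Require Import all_boot all_order all_algebra.
From mathcomp Require Import all_classical all_reals all_analysis.
From mathcomp Require Import ring lra.
Import Order.TTheory GRing.Theory Num.Theory.
Import numFieldNormedType.Exports.
Local Open Scope ring_scope.

(** Everything is read off the one-variable function [f g = W (shear g)], the
    energy along the simple shears [shear g = 1 + g N], where [N] is the
    nilpotent matrix unit.

    The shears form a straight line contained in SL(2).  A convex function of
    [(F, det F)] restricts to a convex function on that line, so [f] is convex;
    it is differentiable because [W] is.  The singular values of
    [shear (2 sinh r)] are [exp r] and [exp (- r)], and two matrices of SL(2)
    with the same singular values differ by rotations on both sides
    ([shear_singular_values]).  Hence isotropy yields two facts: [f] is even,
    since [shear g] and [shear (- g)] have the same singular values, and
    [W (exp X) = f (2 sinh r)] for a symmetric traceless [X] with eigenvalues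
    [r] and [- r] ([What_shear]).

    So [What W] is a radial function [h r = f (2 sinh r)] on the plane of
    symmetric traceless matrices, where [sqrt 2 r] is the Frobenius norm of
    [X].  Its gradient for the Frobenius product is the radial field
    [h' r / (2 r) X] ([kirchhoffE]).  Being even
    and convex, [f] satisfies [f' 0 = 0] and [f'] is nondecreasing, so
    [h' r = 2 cosh r f' (2 sinh r)] is nonnegative and nondecreasing for
    [0 <= r]: it is a product of two such functions.  A radial field whose
    length is a nondecreasing function of [r] is monotone, by the
    Cauchy-Schwarz inequality ([radial_monotone]), and this is the weak Hill
    inequality. *)

(** * Two-by-two matrices *)

Definition mx22 {R : realType} (a b c d : R) : 'M[R]_2 :=
  \matrix_(i, j) if i == 0 then if j == 0 then a else b
                 else if j == 0 then c else d.

Lemma mx22P (R : realType) (A : 'M[R]_2) :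
  A = mx22 (A 0 0) (A 0 1) (A 1 0) (A 1 1).
Proof.
apply/matrixP => i j; rewrite mxE.
by case: (unliftP 0 i) => [i'|] ->; case: (unliftP 0 j) => [j'|] -> //=;
  rewrite ?ord1 //; congr (A _ _); apply/val_inj.
Qed.

Lemma mx22_eta (R : realType) (A : 'M[R]_2) : exists a b c d, A = mx22 a b c d.
Proof. by do 4!eexists; exact: mx22P. Qed.

Lemma add_mx22 (R : realType) (a b c d a' b' c' d' : R) :
  mx22 a b c d + mx22 a' b' c' d' = mx22 (a + a') (b + b') (c + c') (d + d').
Proof. by rewrite [LHS]mx22P !mxE. Qed.

Lemma opp_mx22 (R : realType) (a b c d : R) :
  - mx22 a b c d = mx22 (- a) (- b) (- c) (- d).
Proof. by rewrite [LHS]mx22P !mxE. Qed.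

Lemma scale_mx22 (R : realType) (k a b c d : R) :
  k *: mx22 a b c d = mx22 (k * a) (k * b) (k * c) (k * d).
Proof. by rewrite [LHS]mx22P !mxE. Qed.

Lemma scalar_mx22 (R : realType) (k : R) : k%:M = mx22 k 0 0 k.
Proof. by rewrite [LHS]mx22P !mxE. Qed.

Lemma mul_mx22 (R : realType) (a b c d a' b' c' d' : R) :
  mx22 a b c d *m mx22 a' b' c' d' =
  mx22 (a * a' + b * c') (a * b' + b * d') (c * a' + d * c') (c * b' + d * d').
Proof. by rewrite [LHS]mx22P !mxE !big_ord_recl !big_ord0 !mxE !addr0. Qed.

Lemma tr_mx22 (R : realType) (a b c d : R) : (mx22 a b c d)^T = mx22 a c b d.
Proof. by rewrite [LHS]mx22P !mxE. Qed.

Lemma trace_mx22 (R : realType) (a b c d : R) : \tr (mx22 a b c d) = a + d.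
Proof. by rewrite /mxtrace !big_ord_recl big_ord0 !mxE addr0. Qed.

Lemma det_mx22 (R : realType) (a b c d : R) :
  \det (mx22 a b c d) = a * d - b * c.
Proof.
rewrite (expand_det_row _ ord0) !big_ord_recl big_ord0 addr0 /cofactor.
rewrite !det_mx11 !mxE /= expr0 expr1; ring.
Qed.

Lemma mx22_inj (R : realType) (a b c d a' b' c' d' : R) :
  mx22 a b c d = mx22 a' b' c' d' -> [/\ a = a', b = b', c = c' & d = d'].
Proof.
by move=> /matrixP e; split; [have := e 0 0 | have := e 0 1 | have := e 1 0
  | have := e 1 1]; rewrite !mxE.
Qed.

Definition mx22E := (scalar_mx22, opp_mx22, scale_mx22, add_mx22, mul_mx22,
  tr_mx22, trace_mx22, det_mx22).

Lemma devSym2P (R : realType) (X : 'M[R]_2) :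
  devSym2 X <-> exists x y, X = mx22 x y y (- x).
Proof.
split=> [|[x [y ->]]]; last by split; rewrite !mx22E ?subrr.
have [a [b [c [d ->]]]] := mx22_eta R X.
rewrite /devSym2 /= !mx22E => -[/mx22_inj[_ bc _ _] /eqP].
by rewrite addr_eq0 => /eqP ->; exists (- d), b; rewrite opprK bc.
Qed.

Lemma rotation_SO2 (R : realType) (p q : R) :
  p ^+ 2 + q ^+ 2 = 1 -> SO2 (mx22 p (- q) q p).
Proof.
by move=> pq; split; rewrite !mx22E; [congr mx22|]; rewrite -?pq; ring.
Qed.

(** * Hyperbolic functions *)

Definition cosh {R : realType} (r : R) : R := (expR r + expR (- r)) / 2.

Definition sinh {R : realType} (r : R) : R := (expR r - expR (- r)) / 2.

Lemma cosh_gt0 (R : realType) (r : R) : 0 < cosh r.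
Proof. by rewrite divr_gt0 ?addr_gt0 ?expR_gt0. Qed.

Lemma cosh2 (R : realType) (r : R) : cosh r ^+ 2 = 1 + sinh r ^+ 2.
Proof.
have e : expR r * expR (- r) = 1 by rewrite -expRD subrr expR0.
transitivity (expR r * expR (- r) + sinh r ^+ 2); last by rewrite e.
by rewrite /cosh /sinh; field.
Qed.

Lemma sinh0 (R : realType) : sinh 0 = 0 :> R.
Proof. by rewrite /sinh oppr0 subrr mul0r. Qed.

Lemma cosh0 (R : realType) : cosh 0 = 1 :> R.
Proof. by rewrite /cosh oppr0 expR0; field. Qed.

Lemma sinhN (R : realType) (r : R) : sinh (- r) = - sinh r.
Proof. by rewrite /sinh opprK -mulNr opprB. Qed.

Lemma ler_sinh (R : realType) (r s : R) : r <= s -> sinh r <= sinh s.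
Proof.
by move=> rs; rewrite ler_pM2r // lerB // ler_expR // lerN2.
Qed.

Lemma sinh_ge0 (R : realType) (r : R) : 0 <= r -> 0 <= sinh r.
Proof. by move=> /ler_sinh; rewrite sinh0. Qed.

Lemma ler_cosh (R : realType) (r s : R) : 0 <= r -> r <= s -> cosh r <= cosh s.
Proof.
move=> r0 rs; rewrite -ler_sqr ?nnegrE ?(ltW (cosh_gt0 R _)) // !cosh2 lerD2l.
by rewrite ler_sqr ?nnegrE ?sinh_ge0 ?ler_sinh // (le_trans r0).
Qed.

Lemma is_derive_sinh (R : realType) (r : R) : is_derive r 1 sinh (cosh r).
Proof.
have -> : sinh = 2^-1 *: (expR - (expR \o -%R)) :> (R -> R).
  by apply/funext => s; rewrite /sinh mulrC.
have expN : is_derive r 1 (expR \o -%R) (expR (- r) * -1).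
  by apply: is_derive1_comp.
apply: is_derive_eq; rewrite /cosh /GRing.scale /=; ring.
Qed.

(** * Convex functions of one real variable *)

Local Open Scope classical_set_scope.

Lemma is_derive_cvg (R : realType) (f : R -> R) (x df : R) :
  is_derive x 1 f df -> h^-1 * (f (x + h) - f x) @[h --> (0 : R)^'] --> df.
Proof.
case=> f_der <-.
have -> : (fun h => h^-1 * (f (x + h) - f x)) =
    (fun h => h^-1 *: ((f \o shift x) (h *: 1) - f x)).
  by apply/funext => h; rewrite (addrC x) /= /GRing.scale /= mulr1.
exact: f_der.
Qed.

Lemma convex_functionE (R : realType) (f : R -> R) (x y t : R) :
  convex_function [set: R^o] f -> 0 <= t -> t <= 1 ->
  f (t * x + (1 - t) * y) <= t * f x + (1 - t) * f y.
Proof.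
move=> f_conv t0 t1.
exact: f_conv (Itv01 t0 t1) x y (in_setT _) (in_setT _).
Qed.

(** The chord from [x] to [y] lies above the graph, so the difference quotients
    of [h |-> f (x + h * (y - x))] at [0] are at most [f y - f x] for
    [0 < h <= 1]; their limit is [df * (y - x)]. *)
Lemma convex_tangent (R : realType) (f : R -> R) (x y df : R) :
  convex_function [set: R^o] f -> is_derive x 1 f df ->
  f x + df * (y - x) <= f y.
Proof.
move=> f_conv fx.
pose p (h : R) := f (x + h * (y - x)).
have px : is_derive (0 : R) 1 p (df * (y - x)).
  apply: (@is_derive1_comp _ f (fun h => x + h * (y - x))).
    by rewrite mul0r addr0.
  by apply: is_derive_eq; rewrite /GRing.scale /=; ring.
have /= p_cvg := is_derive_cvg _ _ _ _ px.
have : h^-1 * (p (0 + h) - p 0) @[h --> 0^'+] --> df * (y - x).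
  exact: cvg_dnbhs_at_right p_cvg.
move=> p_lim; rewrite addrC -lerBrDr; apply: (cvgr_to_le p_lim); near=> h.
have h0 : 0 < h by [].
have h1 : h <= 1 by near: h; exact: nbhs_right_le.
rewrite /p add0r mul0r addr0 ler_pdivrMl //.
have := convex_functionE _ _ y x _ f_conv (ltW h0) h1.
have -> : h * y + (1 - h) * x = x + h * (y - x) by ring.
by move=> f_h; rewrite lerBlDr; apply: le_trans f_h _; lra.
Unshelve. all: by end_near. Qed.

(** Add the tangent inequalities at [x] and at [y]. *)
Lemma convex_derive_le (R : realType) (f : R -> R) (x y dfx dfy : R) :
  convex_function [set: R^o] f -> is_derive x 1 f dfx -> is_derive y 1 f dfy ->
  x <= y -> dfx <= dfy.
Proof.
move=> f_conv fx fy; rewrite le_eqVlt => /predU1P[xy|xy].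
  by move: fx fy; rewrite xy => -[_ <-] [_ <-].
have := convex_tangent _ _ _ y _ f_conv fx.
have := convex_tangent _ _ _ x _ f_conv fy.
nra.
Qed.

Lemma even_derive0 (R : realType) (f : R -> R) (df : R) :
  (forall x, f (- x) = f x) -> is_derive (0 : R) 1 f df -> df = 0.
Proof.
move=> f_even f0.
have : is_derive (0 : R) 1 (f \o -%R) (df * -1).
  by apply: is_derive1_comp; rewrite oppr0.
have -> : f \o -%R = f by apply/funext => x /=.
case=> _ + ; case: f0 => _ ->; lra.
Qed.

(** * The energy along simple shears *)

Definition shear {R : realType} (g : R) : 'M[R]_2 := mx22 1 g 0 1.

Lemma shear_SL2 (R : realType) (g : R) : SL2 (shear g).
Proof. by rewrite /SL2 /shear /= mx22E; ring. Qed.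

(** Half-angle formulas: [p + i q] is a square root of the unit complex number
    [x + i y]. *)
Lemma unit_complex_sqrt (R : realType) (x y : R) : x ^+ 2 + y ^+ 2 = 1 ->
  exists p q, [/\ p ^+ 2 + q ^+ 2 = 1, p ^+ 2 - q ^+ 2 = x & 2 * p * q = y].
Proof.
move=> xy.
have x1 : 0 <= (1 + x) / 2 by nra.
have x2 : 0 <= (1 - x) / 2 by nra.
pose p := Num.sqrt ((1 + x) / 2); pose q := Num.sqrt ((1 - x) / 2).
have pE : p ^+ 2 = (1 + x) / 2 by rewrite sqr_sqrtr.
have qE : q ^+ 2 = (1 - x) / 2 by rewrite sqr_sqrtr.
have pqE : 2 * p * q = `|y|.
  rewrite -[LHS]ger0_norm ?mulr_ge0 ?sqrtr_ge0//.
  apply/eqP; rewrite -(@eqrXn2 _ 2) ?normr_ge0 // !real_normK ?num_real //.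
  by rewrite !exprMn pE qE; apply/eqP; lra.
have [y0|y0] := leP 0 y.
  by exists p, q; rewrite pE qE pqE ger0_norm//; split => //; field.
exists p, (- q); rewrite sqrrN pE qE mulrN pqE ltr0_norm // opprK.
by split => //; field.
Qed.

(** The matrix on the right is [c + s E] with [E] the reflection of coordinates
    [(x, y)]; its eigenvalues [c + s] and [c - s] are, up to sign, the singular
    values of [shear (2 * s)].  In complex notation a matrix acts as
    [z |-> a z + b conj z].  The second factor of [Q1] is the rotation which
    makes the coefficient [a] of the shear real, that is, which makes the matrix
    symmetric (polar decomposition); conjugating by the rotation of angle [t]
    then multiplies [b] by [exp (2 i t)], which is why a complex square root
    is needed. *)
Lemma shear_singular_values (R : realType) (c s x y : R) :
  c != 0 -> c ^+ 2 = 1 + s ^+ 2 -> x ^+ 2 + y ^+ 2 = 1 ->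
  exists Q1 Q2, [/\ SO2 Q1, SO2 Q2 &
    Q1 *m shear (2 * s) *m Q2 =
    mx22 (c + s * x) (s * y) (s * y) (c - s * x)].
Proof.
move=> c0 cs xy.
have c2 : c ^- 2 = (1 + s ^+ 2)^-1 by rewrite cs.
have cs0 : 1 + s ^+ 2 != 0 by rewrite -cs expf_neq0.
have [|p [q [pq1 pqx pqy]]] :=
  @unit_complex_sqrt R ((y - s * x) / c) (- (s * y + x) / c).
  rewrite !exprMn exprVn c2 sqrrN -mulrDl.
  have -> : (y - s * x) ^+ 2 + (s * y + x) ^+ 2 =
      (1 + s ^+ 2) * (x ^+ 2 + y ^+ 2) by ring.
  by rewrite xy mulr1 mulfV.
exists (mx22 p (- q) q p *m mx22 c^-1 (- (s / c)) (s / c) c^-1).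
exists (mx22 p (- - q) (- q) p); split.
- rewrite !mx22E.
  have := @rotation_SO2 R ((p - q * s) / c) ((q + p * s) / c).
  have -> : mx22 ((p - q * s) / c) (- ((q + p * s) / c))
                 ((q + p * s) / c) ((p - q * s) / c) =
      mx22 (p / c + - q * (s / c)) (p * - (s / c) + - q / c)
           (q / c + p * (s / c)) (q * - (s / c) + p / c).
    by congr mx22; field.
  apply; rewrite !exprMn exprVn c2.
  rewrite -mulrDl.
  have -> : (p - q * s) ^+ 2 + (q + p * s) ^+ 2 =
      (1 + s ^+ 2) * (p ^+ 2 + q ^+ 2) by ring.
  by rewrite pq1 mulr1 mulfV.
- by apply: rotation_SO2; rewrite sqrrN.
- have xE : x = - (2 * p * q + s * (p ^+ 2 - q ^+ 2)) * c^-1.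
    by rewrite pqx pqy; apply: (mulIf cs0); rewrite -[in RHS]cs; field.
  have yE : y = (p ^+ 2 - q ^+ 2 - s * (2 * p * q)) * c^-1.
    by rewrite pqx pqy; apply: (mulIf cs0); rewrite -[in RHS]cs; field.
  have cE : c = (1 + s ^+ 2) * (p ^+ 2 + q ^+ 2) * c^-1.
    by rewrite pq1 mulr1 -cs; field.
  rewrite !mx22E xE yE; move: cE; set ci := c^-1 => ->.
  by congr mx22; ring.
Qed.

Lemma shear_energyE (R : realType) (W : 'M[R]_2 -> R) (c s x y : R) :
  objective_isotropic W ->
  c != 0 -> c ^+ 2 = 1 + s ^+ 2 -> x ^+ 2 + y ^+ 2 = 1 ->
  W (mx22 (c + s * x) (s * y) (s * y) (c - s * x)) = W (shear (2 * s)).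
Proof.
move=> W_inv c0 cs xy.
have [Q1 [Q2 [SO1 SO2 <-]]] := @shear_singular_values R c s x y c0 cs xy.
by rewrite W_inv //; exact: shear_SL2.
Qed.

(** The data [s], [E] and [- s], [- E] describe the same matrix [c + s E]. *)
Lemma shear_energy_even (R : realType) (W : 'M[R]_2 -> R) (g : R) :
  objective_isotropic W -> W (shear (- g)) = W (shear g).
Proof.
move=> W_inv.
pose s := g / 2; pose c := Num.sqrt (1 + s ^+ 2).
have c2 : c ^+ 2 = 1 + s ^+ 2 by rewrite sqr_sqrtr // addr_ge0 // sqr_ge0.
have c0 : c != 0 by rewrite gt_eqF // sqrtr_gt0 ltr_pwDl // sqr_ge0.
have gE : g = 2 * s by rewrite /s; field.
rewrite [in RHS]gE -(@shear_energyE R W c s 1 0) ?expr1n ?expr0n ?addr0 //.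
rewrite gE -mulrN -(@shear_energyE R W c (- s) (- 1) 0) ?sqrrN ?expr1n
  ?expr0n ?addr0 //.
by rewrite !mulrNN !mulr0.
Qed.

(** The pairs [(shear g, 1)] form a straight line on which the convex function
    of the pair [(F, det F)] coincides with the energy. *)
Lemma shear_energy_convex (R : realType) (W : 'M[R]_2 -> R) :
  polyconvex W -> convex_function [set: R^o] (fun g => W (shear g)).
Proof.
move=> [P [[_ P_conv] WP]] t x y _ _.
rewrite [leRHS]convRE [X in shear X]convRE /=.
have := P_conv (shear y, 1) (shear x, 1) t%:num.
rewrite ge0 le1 => /(_ isT).
have -> : (1 - t%:num) *: ((shear y, 1) : 'M[R]_2 * R^o) +
    t%:num *: ((shear x, 1) : 'M[R]_2 * R^o) =
    (shear (t%:num * x + (1 - t%:num) * y), 1).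
  by congr pair => /=; [rewrite /shear !mx22E; congr mx22|];
    rewrite /GRing.scale /=; ring.
have PE g : P (shear g, 1) = (W (shear g))%:E.
  by rewrite WP //; exact: shear_SL2.
by rewrite !PE -!EFinM -EFinD lee_fin [X in _ <= X -> _]addrC.
Qed.

(** The line of shears stays in SL(2), so near [g] the difference quotients of
    the energy are those of its ambient extension [G] in the direction [N]. *)
Lemma shear_energy_derivable (R : realType) (W : 'M[R]_2 -> R) (g : R) :
  differentiable_SL2 W -> derivable (fun g => W (shear g) : R) g 1.
Proof.
move=> /(_ _ (@shear_SL2 R g))[G [G_diff WG]].
pose N : 'M[R]_2 := mx22 0 1 0 0.
have shearD (h : R) : h *: N + shear g = shear (h + g).
  by rewrite /N /shear !mx22E; congr mx22; ring.
have WG0 : G (shear g) = W (shear g).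
  exact: (nbhs_singleton WG (@shear_SL2 R g)).
have near_shear : \forall h \near (0 : R)^', SL2 (shear (h + g)) ->
    G (shear (h + g)) = W (shear (h + g)).
  have h0 : h *: N + shear g @[h --> (0 : R)^'] --> shear g.
    rewrite -[X in _ --> X]add0r -(scale0r N).
    apply: cvgD; last exact: cvg_cst.
    by apply: cvgZr_tmp; exact: nbhs_dnbhs.
  have {h0} : \forall h \near (0 : R)^', SL2 (h *: N + shear g) ->
      G (h *: N + shear g) = W (h *: N + shear g) by exact: h0 WG.
  apply: filterS => h /=.
  by rewrite shearD.
have quotE : \forall h \near (0 : R)^',
    h^-1 *: ((G \o shift (shear g)) (h *: N) - G (shear g)) =
    h^-1 *: (((fun g => W (shear g)) \o shift g) (h *: 1) - W (shear g)).
  apply: filterS near_shear => h /(_ (@shear_SL2 R _)) Gh.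
  by rewrite /= shearD WG0 Gh /GRing.scale /= mulr1.
have := @diff_derivable _ _ _ G (shear g) N G_diff.
rewrite /derivable; set quotG := (X in cvg X); set quotW := (X in _ -> cvg X).
suff -> : quotG = quotW by [].
apply/seteqP; split; apply: near_eq_cvg => //.
by apply: filterS quotE => h ->.
Qed.

(** * The exponential of symmetric matrices *)

(** If [r != 0] then [E] is an involution, so [a + r E] has the eigenvalues
    [a + r] and [a - r] on the two eigenspaces of [E].  If [r = 0] both sides
    are [a ^ k], whatever [E] is; the hypothesis, which is [E * E = 1]
    multiplied by [r], covers both cases at once. *)
Lemma expr_scalarD (R : realType) (n : nat) (a r : R) (E : 'M[R]_n.+1)
    (k : nat) :
  r *: (E * E) = r *: 1 ->
  (a%:M + r *: E) ^+ k =
  (((a + r) ^+ k + (a - r) ^+ k) / 2) *: 1 +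
  (((a + r) ^+ k - (a - r) ^+ k) / 2) *: E.
Proof.
move=> rE; elim: k => [|k IHk].
  rewrite !expr0 subrr mul0r scale0r addr0 -mulr2n.
  by rewrite divff ?pnatr_eq0 // scale1r.
rewrite exprS IHk; set p := (_ + _) / 2; set q := (_ - _) / 2.
have -> : ((a + r) ^+ k.+1 + (a - r) ^+ k.+1) / 2 = a * p + q * r.
  by rewrite /p /q !exprS; field.
have -> : ((a + r) ^+ k.+1 - (a - r) ^+ k.+1) / 2 = a * q + r * p.
  by rewrite /p /q !exprS; field.
move: p q => p q; rewrite -scalemx1 -[1%:M]/1 mulrDl !mulrDr.
rewrite -!scalerAl -!scalerAr !mul1r !mulr1.
rewrite (scalerA r q) (mulrC r q) -(scalerA q r (E * E)) rE !scalerA !scalerDl.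
by rewrite [X in _ + X = _]addrC addrACA.
Qed.

Lemma expm_scalarD (R : realType) (n : nat) (a r : R) (E : 'M[R]_n.+1) :
  r *: (E * E) = r *: 1 ->
  expm (a%:M + r *: E) =
  expR a *: (cosh r *: 1 + sinh r *: E).
Proof.
move=> rE.
pose S (x : R) (k : nat) := series (exp_coeff x) k.
have eE : series (fun k : nat => (k`!%:R)^-1 *: (a%:M + r *: E) ^+ k) =
    (fun k => ((S (a + r) k + S (a - r) k) / 2) *: 1 +
              ((S (a + r) k - S (a - r) k) / 2) *: E).
  apply/funext => k; rewrite /S /series /=.
  rewrite -sumrB -big_split /= !mulr_suml !scaler_suml -big_split /=.
  apply: eq_bigr => i _.
  rewrite expr_scalarD // scalerDr !scalerA.
  by congr (_ *: _ + _ *: _); rewrite -?mulrDl -?mulrBl mulrA (mulrC _^-1).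
rewrite /expm eE; apply/cvg_lim => //.
have ce (x : R) : S x @ \oo --> expR x by exact: is_cvg_series_exp_coeff.
have -> : expR a *: (cosh r *: 1 + sinh r *: E) =
    ((expR (a + r) + expR (a - r)) / 2) *: 1 +
    ((expR (a + r) - expR (a - r)) / 2) *: E.
  rewrite scalerDr !scalerA /cosh /sinh !expRD.
  by congr (_ *: _ + _ *: _); ring.
apply: cvgD; apply: cvgZr_tmp; apply: cvgMr_tmp.
- exact: (cvgD (ce _) (ce _)).
- exact: (cvgB (ce _) (ce _)).
Qed.

(** The eigenvalues of the symmetric traceless matrix [mx22 x y y (- x)] are
    [radius x y] and its opposite. *)
Definition radius {R : realType} (x y : R) : R := Num.sqrt (x ^+ 2 + y ^+ 2).

Lemma radius_ge0 (R : realType) (x y : R) : 0 <= radius x y.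
Proof. exact: sqrtr_ge0. Qed.

Lemma radius2 (R : realType) (x y : R) : radius x y ^+ 2 = x ^+ 2 + y ^+ 2.
Proof. by rewrite sqr_sqrtr // addr_ge0 ?sqr_ge0. Qed.

Lemma radius_eq0 (R : realType) (x y : R) : radius x y = 0 -> x = 0 /\ y = 0.
Proof.
move=> r0; have /eqP := radius2 R x y.
rewrite r0 expr0n eq_sym paddr_eq0 ?sqr_ge0 // !sqrf_eq0.
by move=> /andP[/eqP -> /eqP ->].
Qed.

Lemma radius_unit (R : realType) (x y : R) : radius x y != 0 ->
  (x / radius x y) ^+ 2 + (y / radius x y) ^+ 2 = 1.
Proof.
by move=> r0; rewrite !exprMn -mulrDl -radius2 -exprMn mulfV // expr1n.
Qed.

(** Every symmetric matrix is [a + r E] with [E] a reflection.  For [r = 0] the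
    quotients by [r] are [0], and so is their factor [sinh r]. *)
Lemma expm_sym (R : realType) (a x y : R) (r := radius x y) :
  expm (mx22 (a + x) y y (a - x)) =
  expR a *: mx22 (cosh r + sinh r * (x / r)) (sinh r * (y / r))
                 (sinh r * (y / r)) (cosh r - sinh r * (x / r)).
Proof.
have -> : mx22 (a + x) y y (a - x) =
    a%:M + r *: mx22 (x / r) (y / r) (y / r) (- (x / r)).
  rewrite !mx22E !add0r mulrN.
  have [r0|r0] := eqVneq r 0.
    have [-> ->] := radius_eq0 _ _ _ r0.
    by rewrite !mul0r !mulr0.
  by rewrite ![r * (_ / r)]mulrC !divfK.
rewrite expm_scalarD.
  by rewrite -[1 : 'M[R]_2]/(1%:M) !mx22E; congr mx22; ring.
have [->|r0] := eqVneq r 0; first by rewrite !scale0r.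
congr (_ *: _); rewrite -[1 : 'M[R]_2]/(1%:M) -[_ * _]/(_ *m _) !mx22E.
by rewrite -(radius_unit _ _ _ r0); congr mx22; ring.
Qed.

Lemma det_expm_sym (R : realType) (a x y : R) :
  \det (expm (mx22 (a + x) y y (a - x))) = expR a ^+ 2.
Proof.
rewrite expm_sym; set r := radius x y; rewrite !mx22E.
have [->|r0] := eqVneq r 0; first by rewrite sinh0 cosh0; ring.
transitivity (expR a ^+ 2 * (cosh r ^+ 2 -
    sinh r ^+ 2 * ((x / r) ^+ 2 + (y / r) ^+ 2))); first by ring.
by rewrite radius_unit // cosh2; ring.
Qed.

(** A symmetric matrix whose exponential has determinant [1] is traceless, since
    the determinant of the exponential is the exponential of the trace; the
    default value [0] of the logarithm is traceless as well. *)
Lemma logm_devSym2 (R : realType) (V : 'M[R]_2) :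
  \det V = 1 -> devSym2 (logm V).
Proof.
rewrite /logm => detV; case: xgetP => [X _ [X_sym XV]|_]; last first.
  by rewrite /devSym2 /= trmx0 mxtrace0.
have [a [b [c [d XE]]]] := mx22_eta R X.
move: X_sym; rewrite XE mx22E => /mx22_inj[_ bc _ _].
pose m := (a + d) / 2; pose x := (a - d) / 2.
have XE' : X = mx22 (m + x) b b (m - x).
  by rewrite XE -bc; congr mx22; rewrite /m /x; field.
have : \det (expm X) = 1 by rewrite XV.
rewrite XE' det_expm_sym => /eqP; rewrite sqrp_eq1 ?expR_ge0 // => /eqP em.
have m0 : m = 0 by apply: (@expR_inj R); rewrite em expR0.
apply/devSym2P; exists x, b; rewrite bc.
suff -> : d = - x by congr mx22; move: m0; rewrite /m /x; lra.
by move: m0; rewrite /m /x; lra.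
Qed.

(** * The Kirchhoff stress is a radial field *)

Lemma What_shear (R : realType) (W : 'M[R]_2 -> R) (x y : R) :
  objective_isotropic W ->
  What W (mx22 x y y (- x)) = W (shear (2 * sinh (radius x y))).
Proof.
move=> W_inv; rewrite /What -{1}[x]add0r -[- x]add0r expm_sym expR0 scale1r.
have [r0|r0] := eqVneq (radius x y) 0.
  by rewrite r0 sinh0 cosh0 !mul0r mulr0 addr0 subr0.
apply: shear_energyE => //; [|exact: cosh2|exact: radius_unit].
by rewrite gt_eqF ?cosh_gt0.
Qed.

Lemma frob_dev (R : realType) (x y a b : R) :
  frob (mx22 x y y (- x)) (mx22 a b b (- a)) = 2 * (x * a + y * b).
Proof. by rewrite /frob !mx22E; ring. Qed.

Lemma frob_dev_eq0 (R : realType) (X : 'M[R]_2) :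
  devSym2 X -> frob X X = 0 -> X = 0.
Proof.
move=> /devSym2P[x [y ->]]; rewrite frob_dev => xy.
have [|-> ->] := @radius_eq0 R x y.
  by apply/eqP; rewrite -sqrf_eq0 radius2; apply/eqP; lra.
by rewrite [RHS]mx22P !mxE oppr0.
Qed.

Lemma is_kirchhoff_uniq (R : realType) (W : 'M[R]_2 -> R) (X T1 T2 : 'M[R]_2) :
  is_kirchhoff W X T1 -> is_kirchhoff W X T2 -> T1 = T2.
Proof.
move=> [T1dev T1W] [T2dev T2W].
have Ddev : devSym2 (T1 - T2).
  move: T1dev T2dev => /devSym2P[x [y ->]] /devSym2P[x' [y' ->]].
  apply/devSym2P; exists (x - x'), (y - y').
  by rewrite !mx22E; congr mx22; ring.
apply/eqP; rewrite -subr_eq0; apply/eqP; apply: frob_dev_eq0 => //.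
rewrite {1}/frob mulmxBr raddfB /= -!/(frob _ _).
rewrite (cvg_unique _ (T1W _ Ddev) (T2W _ Ddev)) ?subrr //.
Qed.

(** The derivative of the radial function [h r = f (2 sinh r)] in the direction
    [(a, b)].  Away from the origin this is the chain rule.  At the origin the
    radius is not differentiable, but evenness of [f] allows replacing
    [radius (t * a) (t * b)] by [t * radius a b] without absolute value, which
    shows that the derivative is [0]; the quotient by [r = 0] agrees with it. *)
Lemma radial_cvg (R : realType) (f : R -> R) (x y a b df : R)
    (r := radius x y) :
  (forall s, f (- s) = f s) -> is_derive (2 * sinh r) 1 f df ->
  t^-1 * (f (2 * sinh (radius (x + t * a) (y + t * b))) - f (2 * sinh r))
    @[t --> (0 : R)^'] --> 2 * (df * cosh r / r * (x * a + y * b)).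
Proof.
move=> f_even fr.
pose h s := f (2 * sinh s); pose rad t := radius (x + t * a) (y + t * b).
have is_derive_h (s ds : R) : is_derive (2 * sinh s) 1 f ds ->
    is_derive s 1 h (ds * (2 * cosh s)).
  move=> fs; apply: (@is_derive1_comp _ f (fun s => 2 * sinh s)) => //.
  have sinh' := is_derive_sinh R s.
  by apply: is_derive_eq; rewrite /GRing.scale /=; ring.
suff [phi [phiE phi0 phi']] : exists phi : R -> R,
    [/\ forall t, h (rad t) = phi t, phi 0 = h r &
      is_derive (0 : R) 1 phi (2 * (df * cosh r / r * (x * a + y * b)))].
  have := is_derive_cvg _ _ _ _ phi'; rewrite phi0.
  suff -> : (fun t => t^-1 * (phi (0 + t) - h r)) =
      (fun t => t^-1 * (h (rad t) - h r)) by [].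
  apply/funext => t; congr (_ * (_ - _)); rewrite (add0r t).
  exact: esym (phiE t).
have [r0|r0] := eqVneq r 0.
  have [x0 y0] := radius_eq0 _ _ _ r0.
  move: fr; rewrite r0 sinh0 mulr0 => fr.
  have df0 := even_derive0 _ _ _ f_even fr.
  exists (fun t => h (t * radius a b)); split.
  - move=> t; rewrite /rad x0 y0 !add0r.
    have -> : radius (t * a) (t * b) = `|t * radius a b|.
      rewrite /radius !exprMn -mulrDr sqrtrM ?sqr_ge0 // sqrtr_sqr normrM.
      by rewrite (ger0_norm (sqrtr_ge0 _)).
    have [t0|t0] := leP 0 (t * radius a b); first by rewrite ger0_norm.
    by rewrite ltr0_norm // /h sinhN mulrN f_even.
  - by rewrite mul0r.
  - have gs : is_derive (0 : R) 1 (fun t => t * radius a b) (radius a b).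
      by apply: is_derive_eq; rewrite /GRing.scale /=; ring.
    have hs : is_derive (0 * radius a b) 1 h (df * (2 * cosh 0)).
      by rewrite mul0r; apply: is_derive_h; rewrite sinh0 mulr0.
    have := @is_derive1_comp _ h (fun t => t * radius a b) _ _ _ hs gs.
    by rewrite df0 !mul0r mulr0.
exists (fun t => h (rad t)); split => //.
  by rewrite /rad !mul0r !addr0.
pose q t := (x + t * a) ^+ 2 + (y + t * b) ^+ 2.
have q0E : q 0 = r ^+ 2 by rewrite /q !mul0r !addr0 radius2.
have r_gt0 : 0 < r by rewrite lt_neqAle eq_sym r0 radius_ge0.
have q' : is_derive (0 : R) 1 q (2 * (x * a + y * b)).
  by apply: is_derive_eq; rewrite /GRing.scale /=; ring.
have rad' : is_derive (0 : R) 1 rad ((2 * r)^-1 * (2 * (x * a + y * b))).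
  apply: (@is_derive1_comp _ Num.sqrt q) => //.
  have -> : r = Num.sqrt (q 0) by rewrite q0E sqrtr_sqr ger0_norm // ltW.
  by apply: is_derive1_sqrt; rewrite q0E exprn_gt0.
have rad0 : rad 0 = r by rewrite /rad !mul0r !addr0.
have hr : is_derive (rad 0) 1 h (df * (2 * cosh r)).
  by rewrite rad0; exact: is_derive_h.
have -> : 2 * (df * cosh r / r * (x * a + y * b)) =
    df * (2 * cosh r) * ((2 * r)^-1 * (2 * (x * a + y * b))).
  by field.
exact: (@is_derive1_comp _ h rad _ _ _ hr rad').
Qed.

Lemma kirchhoffE (R : realType) (W : 'M[R]_2 -> R) (x y df : R)
    (r := radius x y) (c := df * cosh r / r) :
  objective_isotropic W ->
  is_derive (2 * sinh r) 1 (fun g => W (shear g)) df ->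
  kirchhoff W (mx22 x y y (- x)) = c *: mx22 x y y (- x).
Proof.
move=> W_inv fr.
have K : is_kirchhoff W (mx22 x y y (- x)) (c *: mx22 x y y (- x)).
  split; first by apply/devSym2P; exists (c * x), (c * y); rewrite mx22E mulrN.
  move=> _ /devSym2P[a [b ->]].
  have -> : frob (c *: mx22 x y y (- x)) (mx22 a b b (- a)) =
      2 * (c * (x * a + y * b)).
    by rewrite /frob -scalemxAr mxtraceZ -/(frob _ _) frob_dev; ring.
  have WE t : What W (mx22 x y y (- x) + t *: mx22 a b b (- a)) =
      W (shear (2 * sinh (radius (x + t * a) (y + t * b)))).
    rewrite -What_shear // !mx22E; congr (What W _); congr mx22; ring.
  under eq_cvg do rewrite WE What_shear //.
  apply: (radial_cvg _ (fun g => W (shear g))) => // s.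
  exact: shear_energy_even.
apply: (is_kirchhoff_uniq R W _ _ _ _ K).
exact: (@xgetI _ 0 [set T | is_kirchhoff W (mx22 x y y (- x)) T] _ K).
Qed.

(** With [u] and [v] the two points, the conclusion exceeds the product in the
    last hypothesis by [(c1 + c2) (|u| |v| - <u, v>)]. *)
Lemma radial_monotone (R : realType) (c1 c2 x1 y1 x2 y2 : R)
  (r1 := radius x1 y1) (r2 := radius x2 y2) :
  0 <= c1 -> 0 <= c2 -> 0 <= (c1 * r1 - c2 * r2) * (r1 - r2) ->
  0 <= (c1 * x1 - c2 * x2) * (x1 - x2) + (c1 * y1 - c2 * y2) * (y1 - y2).
Proof.
move=> c1_ge0 c2_ge0 cr.
have CS : x1 * x2 + y1 * y2 <= r1 * r2.
  apply: le_trans (ler_norm _) _.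
  rewrite -ler_sqr ?nnegrE ?mulr_ge0 ?radius_ge0 // real_normK ?num_real //.
  rewrite exprMn !radius2 -subr_ge0.
  have -> : (x1 ^+ 2 + y1 ^+ 2) * (x2 ^+ 2 + y2 ^+ 2) - (x1 * x2 + y1 * y2) ^+ 2
    = (x1 * y2 - y1 * x2) ^+ 2 by ring.
  exact: sqr_ge0.
apply: le_trans cr _; rewrite -subr_ge0.
have -> : (c1 * x1 - c2 * x2) * (x1 - x2) + (c1 * y1 - c2 * y2) * (y1 - y2) -
   (c1 * r1 - c2 * r2) * (r1 - r2) =
   c1 * (x1 ^+ 2 + y1 ^+ 2 - r1 ^+ 2) + c2 * (x2 ^+ 2 + y2 ^+ 2 - r2 ^+ 2)
   + (c1 + c2) * (r1 * r2 - (x1 * x2 + y1 * y2)) by ring.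
rewrite !radius2 !subrr !mulr0 !add0r.
by apply: mulr_ge0; [exact: addr_ge0|rewrite subr_ge0].
Qed.

Local Close Scope classical_set_scope.

(** * The weak Hill inequality *)

Theorem theorem1p2 (R : realType) (W : 'M[R]_2 -> R)
    (W_inv : objective_isotropic W)
    (W_poly : polyconvex W)
    (W_diff : differentiable_SL2 W)
    (V1 V2 : 'M[R]_2) (V1_spd : spd V1) (V2_spd : spd V2)
    (detV1 : \det V1 = 1) (detV2 : \det V2 = 1) :
  0 <= frob (kirchhoff W (logm V1) - kirchhoff W (logm V2))
            (logm V1 - logm V2).
Proof.
have /devSym2P[x1 [y1 ->]] := logm_devSym2 _ _ detV1.
have /devSym2P[x2 [y2 ->]] := logm_devSym2 _ _ detV2.
pose f g := W (shear g).
have f' (g : R) : is_derive g 1 f ('D_1 f g).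
  by apply/derivableP; exact: shear_energy_derivable.
have f'_mono (g h : R) : g <= h -> 'D_1 f g <= 'D_1 f h.
  exact: convex_derive_le (shear_energy_convex R W W_poly) (f' g) (f' h).
have f'0 : 'D_1 f (0 : R) = 0.
  by apply: even_derive0 (f' 0) => g; exact: shear_energy_even.
pose m (r : R) := 'D_1 f (2 * sinh r) * cosh r.
have m_mono (r s : R) : 0 <= r -> r <= s -> 0 <= m r <= m s.
  move=> r0 rs; have D0 : 0 <= 'D_1 f (2 * sinh r).
    by rewrite -f'0; apply: f'_mono; rewrite mulr_ge0 ?sinh_ge0.
  apply/andP; split; first by rewrite mulr_ge0 // ltW // cosh_gt0.
  apply: ler_pM; [exact: D0|exact: ltW (cosh_gt0 R r)| |exact: ler_cosh].
  by apply: f'_mono; rewrite ler_pM2l // ler_sinh.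
have m_ge0 r : 0 <= r -> 0 <= m r.
  by move=> r0; case/andP: (m_mono r r r0 (lexx _)).
have m0 : m 0 = 0 by rewrite /m sinh0 mulr0 f'0 mul0r.
have mrK r : m r / r * r = m r.
  by have [->|r0] := eqVneq r 0; [rewrite mulr0 m0|rewrite divfK].
have tauE x y : kirchhoff W (mx22 x y y (- x)) =
    (m (radius x y) / radius x y) *: mx22 x y y (- x).
  exact: kirchhoffE W_inv (f' _).
rewrite !tauE.
set r1 := radius x1 y1; set r2 := radius x2 y2.
rewrite !mx22E.
have -> (u v : R) : - u - - v = - (u - v) by ring.
have -> : m r1 / r1 * - x1 - m r2 / r2 * - x2 =
    - (m r1 / r1 * x1 - m r2 / r2 * x2) by ring.
rewrite frob_dev mulr_ge0 //.
have r1_ge0 : 0 <= r1 by exact: radius_ge0.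
have r2_ge0 : 0 <= r2 by exact: radius_ge0.
apply: radial_monotone; rewrite ?divr_ge0 ?m_ge0 // !mrK.
have [r12|r21] := leP r1 r2.
  have /andP[_ m12] := m_mono _ _ r1_ge0 r12.
  by apply: mulr_le0; rewrite subr_le0.
have /andP[_ m21] := m_mono _ _ r2_ge0 (ltW r21).
by apply: mulr_ge0; rewrite subr_ge0 // ltW.
Qed.
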